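(* Let $\lambda$ be a successor cardinal with $\lambda^{<\lambda}<\lambda^\lambda=\lambda^+$. If $\square_\lambda$ holds, then $\clubsuit\square_\lambda$ holds.
   Context: For a set of ordinals $A$: $\operatorname{acc}(A)=\{\alpha\in A:\sup(A\cap\alpha)=\alpha\}$; $\operatorname{otp}(A)$ is its order type; $A(i)$ is the unique $\beta\in A$ with $\operatorname{otp}(A\cap\beta)=i$. A $\square_\lambda$-sequence is $\langle C_\alpha:\alpha<\lambda^+\rangle$ such that for every limit $\alpha<\lambda^+$, $C_\alpha$ is a club in $\alpha$ of order type $\le\lambda$, and $\beta\in\operatorname{acc}(C_\alpha)$ implies $C_\beta=C_\alpha\cap\beta$; $\square_\lambda$ asserts one exists. $\clubsuit\square_\lambda$ asserts the existence of a $\square_\lambda$-sequence $\langle C_\alpha\rangle$ such that for every sequence $\langle A_i:i<\lambda\rangle$ of unbounded subsets of $\lambda^+$, every limit $\theta<\lambda$ and every club $D\subseteq\lambda^+$, there is $\alpha<\lambda^+$ with $\operatorname{otp}(C_\alpha)=\theta$ such that for all $i<\theta$: $C_\alpha(i+1)\in A_i$, and $C_\alpha(i)<\beta<C_\alpha(i+1)$ for some $\beta\in D$. *)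

(* Defs.v *)
(* Ordinals below lambda^+ are modelled by a strictly well-ordered
   type K (the ordinal lambda^+ itself); lambda is an element lam : K. *)
From Stdlib Require Import Relations Wellfounded.

Section Defs.
Context {K : Type} (lt : K -> K -> Prop).

Definition le (x y : K) : Prop := lt x y \/ x = y.

Definition strict_well_order : Prop :=
  well_founded lt /\ (forall x y z, lt x y -> lt y z -> lt x z) /\
  (forall x y, lt x y \/ x = y \/ lt y x).

Definition seg (x : K) : Type := { y : K | lt y x }.

Definition is_succ (i j : K) : Prop := lt i j /\ forall k, lt i k -> le j k.

Definition limit (a : K) : Prop :=
  (exists y, lt y a) /\ (forall y, lt y a -> exists z, lt y z /\ lt z a).

Definition acc (A : K -> Prop) (a : K) : Prop :=
  A a /\ (exists y, lt y a) /\ (forall b, lt b a -> exists g, A g /\ lt b g /\ lt g a).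

Definition club_in (C : K -> Prop) (a : K) : Prop :=
  (forall x, C x -> lt x a) /\
  (forall b, lt b a -> exists g, C g /\ lt b g) /\
  (forall b, lt b a -> (exists y, lt y b) ->
     (forall c, lt c b -> exists g, C g /\ lt c g /\ lt g b) -> C b).

Definition club (D : K -> Prop) : Prop :=
  (forall b, exists g, D g /\ lt b g) /\
  (forall b, (exists y, lt y b) ->
     (forall c, lt c b -> exists g, D g /\ lt c g /\ lt g b) -> D b).

Definition unbounded (A : K -> Prop) : Prop := forall b, exists g, A g /\ lt b g.

Definition otp_eq (A : K -> Prop) (t : K) : Prop :=
  exists f : { x | A x } -> seg t,
    (forall x y, lt (proj1_sig x) (proj1_sig y) <-> lt (proj1_sig (f x)) (proj1_sig (f y))) /\
    (forall z, exists x, f x = z).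

Definition otp_le (A : K -> Prop) (t : K) : Prop :=
  exists f : { x | A x } -> seg t,
    forall x y, lt (proj1_sig x) (proj1_sig y) -> lt (proj1_sig (f x)) (proj1_sig (f y)).

Definition elem_at (A : K -> Prop) (i b : K) : Prop :=
  A b /\ otp_eq (fun x => A x /\ lt x b) i.

Definition is_square (lam : K) (C : K -> K -> Prop) : Prop :=
  forall a, limit a ->
    club_in (C a) a /\ otp_le (C a) lam /\
    (forall b, acc (C a) b -> forall x, C b x <-> (C a x /\ lt x b)).

Definition clubsuit_square (lam : K) : Prop :=
  exists C : K -> K -> Prop, is_square lam C /\
    forall (A : K -> K -> Prop), (forall i, lt i lam -> unbounded (A i)) ->
    forall t, lt t lam -> limit t ->
    forall D, club D ->
    exists a, limit a /\ otp_eq (C a) t /\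
      forall i, lt i t ->
        exists j b b', is_succ i j /\ elem_at (C a) i b /\ elem_at (C a) j b' /\
          A i b' /\ exists d, D d /\ lt b d /\ lt d b'.

End Defs.

Definition card_le (A B : Type) : Prop := exists f : A -> B, forall x y, f x = f y -> x = y.
Definition card_lt (A B : Type) : Prop := card_le A B /\ ~ card_le B A.
Definition card_eq (A B : Type) : Prop :=
  exists f : A -> B, (forall x y, f x = f y -> x = y) /\ (forall z, exists x, f x = z).

(* Main.v *)
(* Replacing each successor element of C_alpha by a point lying between its predecessor and itself,
   chosen from the part of C_alpha already built, preserves squares and order types.

   First, C can be assumed to guess clubs: for every limit theta < lambda and club E some C_alpha of
   order type theta is contained in E. Otherwise thin out C along a decreasing sequence of lambda
   many counterexample clubs; the thinned versions of a short C_alpha stabilise. An Ulam matrix then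
   yields a colouring c such that, in addition, c (min C_alpha) = theta.

   Fix theta. A function g from theta to lambda names positions: injections e_beta : beta -> lambda
   turn g(i) and beta = C_alpha(i+1) into an ordinal below beta, read as a code for a function P, which
   proposes a new place for beta. There are only lambda^{<lambda} = lambda many g, so if each of them
   failed, the counterexamples for all g could be coded by the same functions P_b, with 2^lambda =
   lambda^+ codes. On a C_alpha contained in the club of closure points of b |-> P_b, the g that
   names the actual codes succeeds. Since theta is read off from min C_alpha, one sequence serves all
   theta. *)
From Stdlib Require Import Classical ClassicalEpsilon FunctionalExtensionality PropExtensionality ProofIrrelevance.
Require Import Defs.

(** * Cardinal comparison *)

Lemma card_le_trans (A B C : Type) : card_le A B -> card_le B C -> card_le A C.
Proof. intros [f Hf] [g Hg]. exists (fun x => g (f x)). auto. Qed.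

Lemma surj_card_le (A B : Type) (f : A -> B) : (forall z, exists x, f x = z) -> card_le B A.
Proof.
  intros Hf. exists (fun z => proj1_sig (constructive_indefinite_description _ (Hf z))).
  intros z z'.
  destruct (constructive_indefinite_description _ (Hf z)) as [x <-],
    (constructive_indefinite_description _ (Hf z')) as [x' <-]; simpl; congruence.
Qed.

(** Hilbert's hotel: [None] goes to [e 0], each [e n] moves to [e (S n)], and all other points
    stay. *)
Lemma card_le_option (A : Type) : card_le nat A -> card_le (option A) A.
Proof.
  intros [e He].
  assert (Hc : forall a, { n | a = e n } + { forall n, a <> e n }).
  { intro a. destruct (excluded_middle_informative (exists n, a = e n)) as [H|H].
    - left. apply constructive_indefinite_description, H.
    - right. intros n Hn. apply H. now exists n. }
  exists (fun o => match o with
    | None => e 0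
    | Some a => match Hc a with inleft (exist _ n _) => e (S n) | inright _ => a end end).
  intros [a|] [b|]; try destruct (Hc a) as [[n ->]|H]; try destruct (Hc b) as [[m ->]|H'];
    intros E; try reflexivity; try congruence;
    solve [apply He in E; congruence | symmetry in E; exfalso; eauto | exfalso; eauto].
Qed.

(** * Well-orders *)

Section Order.
Context {K : Type} (lt : K -> K -> Prop) (Hwo : strict_well_order lt).
Notation "x < y" := (lt x y).
Notation "x <= y" := (le lt x y).

Lemma lt_trans x y z : x < y -> y < z -> x < z.
Proof. destruct Hwo as (_ & H & _). apply H. Qed.

Lemma lt_irrefl x : ~ x < x.
Proof.
  destruct Hwo as (H & _). intro Hx. pose proof (H x) as Hacc. revert Hx.
  induction Hacc as [y _ IH]. intro Hy. exact (IH y Hy Hy).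
Qed.

Lemma not_lt x y : ~ x < y <-> y <= x.
Proof.
  destruct Hwo as (_ & _ & H). unfold le. split.
  - destruct (H x y) as [?|[?|?]]; auto. tauto.
  - intros [Hy|<-] Hx; apply (lt_irrefl y); [eapply lt_trans; eassumption|assumption].
Qed.

Lemma not_le x y : ~ x <= y <-> y < x.
Proof.
  rewrite <- not_lt. split; [apply NNPP|tauto].
Qed.

Lemma le_lt_trans x y z : x <= y -> y < z -> x < z.
Proof. intros [H| ->] H'; auto. eapply lt_trans; eassumption. Qed.

Lemma lt_le_trans x y z : x < y -> y <= z -> x < z.
Proof. intros H [H'| <-]; auto. eapply lt_trans; eassumption. Qed.

Lemma le_trans x y z : x <= y -> y <= z -> x <= z.
Proof. intros H [H'| <-]; auto. left. eapply le_lt_trans; eassumption. Qed.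

Lemma le_antisym x y : x <= y -> y <= x -> x = y.
Proof. intros [H|H] H'; auto. apply not_lt in H'. tauto. Qed.

Lemma le_refl x : x <= x.
Proof. now right. Qed.

Lemma lt_le x y : x < y -> x <= y.
Proof. now left. Qed.

End Order.

Ltac ord_add P pf := lazymatch goal with _ : P |- _ => fail | _ => assert P by exact pf end.
(* Refutation by saturating the context under transitivity. *)
Ltac ord Hwo :=
  intros; subst;
  repeat match goal with
  | H : ~ le _ _ _ |- _ => apply (not_le _ Hwo) in H
  | H : ~ ?lt _ _ |- _ => apply (not_lt lt Hwo) in H
  end;
  match goal with
  | |- False => idtac
  | |- ~ _ => intro
  | |- le _ _ _ => apply (not_lt _ Hwo); intro
  | |- ?lt _ _ => apply (not_le lt Hwo); intro
  | |- _ = _ => apply (le_antisym _ Hwo); apply (not_lt _ Hwo); intro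
  | _ => exfalso
  end;
  repeat match goal with
  | H : ?lt ?x ?x |- _ => exfalso; exact (lt_irrefl lt Hwo x H)
  | H1 : ?lt ?x ?y, H2 : ?lt ?y ?z |- _ => ord_add (lt x z) (lt_trans lt Hwo x y z H1 H2)
  | H1 : le ?lt ?x ?y, H2 : ?lt ?y ?z |- _ => ord_add (lt x z) (le_lt_trans lt Hwo x y z H1 H2)
  | H1 : ?lt ?x ?y, H2 : le ?lt ?y ?z |- _ => ord_add (lt x z) (lt_le_trans lt Hwo x y z H1 H2)
  | H1 : le ?lt ?x ?y, H2 : le ?lt ?y ?z |- _ => ord_add (le lt x z) (le_trans lt Hwo x y z H1 H2)
  end.

Section Order2.
Context {K : Type} (lt : K -> K -> Prop) (Hwo : strict_well_order lt).
Notation "x < y" := (lt x y).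
Notation "x <= y" := (le lt x y).

Lemma least (P : K -> Prop) : (exists x, P x) -> exists x, P x /\ forall y, P y -> x <= y.
Proof.
  intros [x Hx]. destruct Hwo as (Hw & _). revert Hx. induction (Hw x) as [x _ IH]. intro Hx.
  destruct (classic (exists y, y < x /\ P y)) as [(y & Hy & HP)|H].
  - exact (IH y Hy HP).
  - exists x. split; auto. intros y HP. apply (not_lt lt Hwo). intro. apply H. eauto.
Qed.

(** Transfinite recursion with choice: [P k f] may look at [f] only below [k], and a value is owed
    only if the earlier choices were correct. *)
Lemma wf_choice (T : Type) (P : K -> (K -> T) -> T -> Prop) :
  inhabited T ->
  (forall k f g, (forall j, j < k -> f j = g j) -> forall x, P k f x -> P k g x) ->
  (forall k f, (forall j, j < k -> P j f (f j)) -> exists x, P k f x) ->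
  exists F, forall k, P k F (F k).
Proof.
  intros Hinh Hext Hex.
  set (cut := fun k (rec : forall j, j < k -> T) j =>
    match excluded_middle_informative (j < k) with
    | left h => rec j h
    | right _ => epsilon Hinh (fun _ => True)
    end).
  destruct Hwo as (Hw & _).
  set (F := Fix Hw (fun _ => T) (fun k rec => epsilon Hinh (P k (cut k rec)))).
  assert (HF : forall k, F k = epsilon Hinh (P k F)).
  { intro k. unfold F at 1. rewrite Fix_eq.
    - fold F. f_equal. apply functional_extensionality. intro x.
      assert (E : forall j, j < k -> cut k (fun j _ => F j) j = F j).
      { intros j Hj. unfold cut. destruct (excluded_middle_informative _); tauto. }
      apply propositional_extensionality. split; apply Hext; auto.
      intros j Hj. symmetry. auto.
    - intros x f g Hfg. replace g with f; auto.
      apply functional_extensionality_dep. intro y. apply functional_extensionality. intro. auto. }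
  exists F. intro k. induction (Hw k) as [k _ IH].
  rewrite (HF k). apply epsilon_spec. apply Hex. auto.
Qed.

(** List elements of [X] without repetition along [K]. Either the list never runs out, which embeds
    [K], or the elements listed before some [k] exhaust [X]. *)
Lemma card_compare (X : Type) : inhabited X -> card_le K X \/ exists k, card_le X (seg lt k).
Proof.
  intro Hinh.
  destruct (wf_choice X
    (fun k f x => (exists y, forall j, j < k -> f j <> y) -> forall j, j < k -> f j <> x)) as [F HF].
  - exact Hinh.
  - intros k f g E x H (y & Hy) j Hj. rewrite <- E; auto. apply H; auto.
    exists y. intros i Hi. rewrite E; auto.
  - intros k f _. destruct (classic (exists y, forall j, j < k -> f j <> y)) as [(y & Hy)|H].
    + exists y. auto.
    + destruct Hinh as [x]. exists x. tauto.
  - destruct (classic (forall k, exists y, forall j, j < k -> F j <> y)) as [H|H].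
    + left. exists F. intros x y E. destruct Hwo as (_ & _ & Ht).
      destruct (Ht x y) as [L|[L|L]]; auto.
      * exfalso. exact (HF y (H y) x L E).
      * exfalso. exact (HF x (H x) y L (eq_sym E)).
    + right. apply not_all_ex_not in H. destruct H as [k Hk]. exists k.
      apply (surj_card_le _ _ (fun s : seg lt k => F (proj1_sig s))).
      intro y. apply NNPP. intro Hn. apply Hk. exists y. intros j Hj E.
      apply Hn. now exists (exist _ j Hj).
Qed.

Lemma seg_eq b (x y : seg lt b) : proj1_sig x = proj1_sig y -> x = y.
Proof. destruct x, y. simpl. intros ->. f_equal. apply proof_irrelevance. Qed.

(** * Enumerations and order types *)

Definition enum (A : K -> Prop) (t : K) (h : K -> K) : Prop :=
  (forall i, i < t -> A (h i)) /\ (forall i j, i < j -> j < t -> h i < h j) /\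
  (forall a, A a -> exists i, i < t /\ h i = a).

Lemma mono_inj (h : K -> K) t i j : (forall i j, i < j -> j < t -> h i < h j) ->
  i < t -> j < t -> h i < h j -> i < j.
Proof.
  intros H Hi Hj L. apply (not_le lt Hwo). intros [L'| ->]; [|ord Hwo].
  specialize (H j i L' Hi). ord Hwo.
Qed.

Lemma otp_eq_enum A t : otp_eq lt A t <-> exists h, enum A t h.
Proof.
  split.
  - intros (f & Hf & Hs).
    assert (H : forall i, exists a, forall L : i < t, exists p : A a, f (exist _ a p) = exist _ i L).
    { intro i. destruct (classic (i < t)) as [L|L].
      - destruct (Hs (exist _ i L)) as [[a p] E]. exists a. intro L'.
        exists p. rewrite E. now apply seg_eq.
      - exists i. tauto. }
    apply choice in H. destruct H as [h Hh]. exists h. repeat split.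
    + intros i L. now destruct (Hh i L).
    + intros i j Lij Lj. assert (Li : i < t) by ord Hwo.
      destruct (Hh i Li) as [p Ep], (Hh j Lj) as [q Eq].
      apply (Hf (exist _ _ p) (exist _ _ q)). now rewrite Ep, Eq.
    + intros a p. destruct (f (exist _ a p)) as [i L] eqn:E. exists i. split; auto.
      destruct (Hh i L) as [q Eq].
      assert (N : forall x y, f x = f y -> ~ proj1_sig x < proj1_sig y).
      { intros x y Exy C. apply Hf in C. rewrite Exy in C. now apply (lt_irrefl lt Hwo) in C. }
      rewrite <- Eq in E. pose proof (N _ _ E). pose proof (N _ _ (eq_sym E)). simpl in *. ord Hwo.
  - intros (h & HA & Hm & Hs).
    assert (H : forall x : {x | A x}, exists i : seg lt t, h (proj1_sig i) = proj1_sig x).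
    { intros [a p]. destruct (Hs a p) as (i & L & E). now exists (exist _ i L). }
    apply choice in H. destruct H as [f Hf]. exists f. split.
    + intros x y. rewrite <- !Hf. split.
      * intro L. apply (mono_inj h t); auto; apply proj2_sig.
      * intro L. apply Hm; auto. apply proj2_sig.
    + intros [i L]. exists (exist _ (h i) (HA i L)).
      apply seg_eq. simpl. set (x := exist _ _ _). specialize (Hf x). simpl in Hf.
      destruct (f x) as [j Lj]. simpl in *. destruct Hwo as (_ & _ & Ht).
      destruct (Ht i j) as [C|[C|C]]; auto; exfalso.
      * apply Hm in C; auto. rewrite Hf in C. now apply (lt_irrefl lt Hwo) in C.
      * apply Hm in C; auto. rewrite Hf in C. now apply (lt_irrefl lt Hwo) in C.
Qed.

(** At a least [k] with [h k < k], monotonicity gives [h (h k) < h k], so [h k] would be a smaller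
    such point. *)
Lemma mono_ge (h : K -> K) t : (forall i j, i < j -> j < t -> h i < h j) ->
  forall i, i < t -> i <= h i.
Proof.
  intros H i Hi. apply (not_lt lt Hwo). intro C.
  destruct (least (fun i => i < t /\ h i < i)) as (k & (Hk & Lk) & Hmin); eauto.
  assert (L : h k < t) by ord Hwo.
  specialize (Hmin (h k) (conj L (H _ _ Lk Hk))). ord Hwo.
Qed.

(** If [t' < t], then [h] followed by the inverse of [h'] is an increasing map [f] from [t] to [t'],
    and [mono_ge] gives [t' <= f t' < t']. *)
Lemma enum_le A t t' h h' : enum A t h -> enum A t' h' -> t <= t'.
Proof.
  intros (HA & Hm & Hs) (HA' & Hm' & Hs'). apply (not_lt lt Hwo). intro L.
  assert (H : forall i, exists j, i < t -> j < t' /\ h' j = h i).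
  { intro i. destruct (classic (i < t)) as [Li|Li]; [|exists i; tauto].
    destruct (Hs' (h i) (HA i Li)) as [j Hj]. now exists j. }
  apply choice in H. destruct H as [f Hf].
  assert (Hf' : forall i j, i < j -> j < t -> f i < f j).
  { intros i j Lij Lj. assert (Li : i < t) by ord Hwo.
    destruct (Hf i Li) as [Bi Ei], (Hf j Lj) as [Bj Ej].
    apply (mono_inj h' t'); auto. rewrite Ei, Ej. auto. }
  pose proof (mono_ge f t Hf' t' L). destruct (Hf t' L). ord Hwo.
Qed.

Lemma enum_unique A t t' h h' : enum A t h -> enum A t' h' -> t = t'.
Proof. intros H H'. apply (le_antisym lt Hwo); eapply enum_le; eassumption. Qed.

Lemma enum_elem_at A t h i : enum A t h -> i < t -> elem_at lt A i (h i).
Proof.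
  intros (HA & Hm & Hs) L. split; auto. apply otp_eq_enum. exists h. repeat split.
  - apply HA. ord Hwo.
  - auto.
  - intros j k Ljk Lk. apply Hm; auto. ord Hwo.
  - intros a (Ha & La). destruct (Hs a Ha) as (j & Lj & <-). exists j. split; auto.
    apply (mono_inj h t); auto.
Qed.

Lemma elem_at_unique A i j b : elem_at lt A i b -> elem_at lt A j b -> i = j.
Proof.
  intros (_ & H) (_ & H'). apply otp_eq_enum in H, H'. destruct H as [h H], H' as [h' H'].
  eapply enum_unique; eassumption.
Qed.

Lemma otp_le_fun A t : otp_le lt A t <->
  exists f : K -> K, (forall x, A x -> f x < t) /\ (forall x y, A x -> A y -> x < y -> f x < f y).
Proof.
  split.
  - intros [f Hf].
    assert (H : forall x, exists y, forall p : A x, y = proj1_sig (f (exist _ x p))).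
    { intro x. destruct (classic (A x)) as [p|p]; [|exists x; tauto].
      exists (proj1_sig (f (exist _ x p))). intro q. now rewrite (proof_irrelevance _ p q). }
    apply choice in H. destruct H as [g Hg]. exists g. split.
    + intros x p. rewrite (Hg x p). apply proj2_sig.
    + intros x y p q L. rewrite (Hg x p), (Hg y q). now apply Hf.
  - intros (f & Hf & Hm). exists (fun x => exist _ (f (proj1_sig x)) (Hf _ (proj2_sig x))).
    intros [x p] [y q]. simpl. auto.
Qed.

Lemma least_upper (P : K -> Prop) b : (forall x, P x -> x < b) ->
  exists s, (forall x, P x -> x < s) /\ s <= b /\ forall c, c < s -> exists x, P x /\ c <= x.
Proof.
  intro Hb. destruct (least (fun s => forall x, P x -> x < s)) as (s & Hs & Hmin); eauto.
  exists s. repeat split; auto. intros c L. apply NNPP. intro N.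
  assert (H : s <= c); [|ord Hwo]. apply Hmin. intros x Hx.
  apply (not_le lt Hwo). intro C. apply N. eauto.
Qed.

End Order2.
(** * Arithmetic of lambda and its successor *)

Section Cardinals.
Context {K : Type} (lt : K -> K -> Prop) (lam : K).
Notation "x < y" := (lt x y).
Notation "x <= y" := (le lt x y).
Context (Hwo : strict_well_order lt)
  (HK_seg : forall x : K, card_le (seg lt x) (seg lt lam))
  (HK_big : ~ card_le K (seg lt lam))
  (Hsucc : exists mu, lt mu lam /\ card_le nat (seg lt mu) /\
            ~ card_le (seg lt lam) (seg lt mu) /\
            (forall x, lt x lam -> card_le (seg lt x) (seg lt mu)))
  (Hlt : card_lt { m : { m : K | lt m lam } & seg lt (proj1_sig m) -> seg lt lam }
                 (seg lt lam -> seg lt lam))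
  (Heq : card_eq (seg lt lam -> seg lt lam) K).

Lemma seg_small x : x < lam -> ~ card_le (seg lt lam) (seg lt x).
Proof.
  intros L C. destruct Hsucc as (mu & _ & _ & N & H). apply N.
  eapply card_le_trans; [exact C|auto].
Qed.

Lemma nat_seg_lam : card_le nat (seg lt lam).
Proof.
  destruct Hsucc as (mu & _ & H & _). eapply card_le_trans; [exact H|apply HK_seg].
Qed.

Lemma le_option (x : K) : (forall y, y <= x) -> card_le K (option (seg lt x)).
Proof.
  intro H.
  exists (fun y => match excluded_middle_informative (y < x) with
    | left L => Some (exist _ y L) | right _ => None end).
  intros y z. destruct (excluded_middle_informative (y < x)), (excluded_middle_informative (z < x));
    intro E; try discriminate.
  - now injection E.
  - pose proof (H y). pose proof (H z). ord Hwo.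
Qed.

Lemma no_max (b : K) : exists c, b < c.
Proof.
  apply NNPP. intro N. apply HK_big.
  apply (card_le_trans _ (option (seg lt b))).
  - apply le_option. intro y. apply (not_lt lt Hwo). eauto.
  - apply (card_le_trans _ (option (seg lt lam))).
    + destruct (HK_seg b) as [f Hf].
      exists (option_map f). intros [x|] [y|]; simpl; intro E; try discriminate; auto.
      injection E. intro. f_equal. auto.
    + apply card_le_option, nat_seg_lam.
Qed.

Lemma lam_limit i : i < lam -> exists j, i < j /\ j < lam.
Proof.
  intro Hi. apply NNPP. intro N.
  destruct Hsucc as (mu & Lmu & Hnat & Hbig & H). apply Hbig.
  apply (card_le_trans _ (option (seg lt i))).
  - exists (fun y => match excluded_middle_informative (proj1_sig y < i) with
      | left L => Some (exist _ (proj1_sig y) L) | right _ => None end).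
    intros [y p] [z q]; simpl.
    destruct (excluded_middle_informative (y < i)), (excluded_middle_informative (z < i));
      intro E; try discriminate; apply seg_eq; simpl.
    + now injection E.
    + assert (~ i < y) by eauto. assert (~ i < z) by eauto. ord Hwo.
  - apply (card_le_trans _ (option (seg lt mu))).
    + destruct (H i Hi) as [f Hf].
      exists (option_map f). intros [x|] [y|]; simpl; intro E; try discriminate; auto.
      injection E. intro. f_equal. auto.
    + apply card_le_option, Hnat.
Qed.

Definition small (X : Type) : Prop := card_le X (seg lt lam).

(** If lambda^{<lambda} were not at most lambda, then [K], hence lambda^lambda, would embed in it,
    against the strict inequality. *)
Lemma small_pow_lt : small { m : { m : K | lt m lam } & seg lt (proj1_sig m) -> seg lt lam }.
Proof.
  destruct Hlt as [_ N]. destruct Heq as (f & Hf & _).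
  destruct (card_compare lt Hwo { m : { m : K | lt m lam } & seg lt (proj1_sig m) -> seg lt lam })
    as [C|[k C]].
  - destruct Hsucc as (mu & L & _). constructor.
    exists (exist _ mu L). exact (fun _ => exist _ mu L).
  - exfalso. apply N. eapply card_le_trans; [exists f; exact Hf|exact C].
  - eapply card_le_trans; [exact C|apply HK_seg].
Qed.

Lemma small_pow i : i < lam -> small (seg lt i -> seg lt lam).
Proof.
  intro L. eapply card_le_trans; [|apply small_pow_lt].
  exists (fun g => existT (fun m : {m : K | lt m lam} => seg lt (proj1_sig m) -> seg lt lam)
    (exist _ i L) g).
  intros g g' E. now apply inj_pair2 in E.
Qed.

(** A pair becomes a function on [mu] with one coordinate as value at [e 0] and the other elsewhere,
    in particular at [e 1]; so lambda^mu <= lambda bounds the product. *)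
Lemma small_prod (X Y : Type) : small X -> small Y -> small (X * Y).
Proof.
  intros [f Hf] [g Hg]. destruct Hsucc as (mu & L & [e He] & _).
  eapply card_le_trans; [|apply (small_pow mu L)].
  exists (fun p j => if excluded_middle_informative (j = e 0) then f (fst p) else g (snd p)).
  intros [x y] [x' y'] E. simpl in E. f_equal.
  - apply Hf. apply (f_equal (fun h => h (e 0))) in E.
    now destruct (excluded_middle_informative (e 0 = e 0)).
  - apply Hg. apply (f_equal (fun h => h (e 1))) in E.
    destruct (excluded_middle_informative (e 1 = e 0)) as [C|C]; auto.
    apply He in C. discriminate.
Qed.

(* Konig's diagonal argument: a cofinal map from i to lambda gives lambda^i > lambda. *)
Lemma lam_regular (X : Type) i (f : X -> K) :
  i < lam -> card_le X (seg lt i) -> (forall x, f x < lam) ->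
  exists b, b < lam /\ forall x, f x < b.
Proof.
  intros Hi [iota Hiota] Hf. apply NNPP. intro N.
  assert (Hcof : forall b, b < lam -> exists x, b < f x).
  { intros b Lb. apply NNPP. intro N'. destruct (lam_limit b Lb) as (c & Lbc & Lc).
    apply N. exists c. split; auto. intro x.
    assert (~ b < f x) by eauto. ord Hwo. }
  destruct (small_pow i Hi) as [psi Hpsi].
  (* Fewer than lambda functions [h] have [psi h] below [f x], so some [y] differs from all their
     values at [j = iota x]. *)
  assert (Hg : forall j : seg lt i, exists y : seg lt lam,
    forall x, iota x = j -> forall h, proj1_sig (psi h) < f x -> h j <> y).
  { intro j. destruct (classic (exists x, iota x = j)) as [[x Hx]|Nx].
    - apply NNPP. intro C. apply (seg_small (f x) (Hf x)).
      assert (D : forall y : seg lt lam, exists s : seg lt (f x),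
        exists h, proj1_sig (psi h) = proj1_sig s /\ h j = y).
      { intro y. apply NNPP. intro D. apply C. exists y.
        intros x' Hx' h L E. rewrite <- Hx in Hx'. apply Hiota in Hx'. subst x'.
        apply D. exists (exist (fun z => z < f x) _ L). exists h. auto. }
      apply choice in D. destruct D as [s Hs]. exists s. intros y y' E.
      destruct (Hs y) as (h & Eh & <-), (Hs y') as (h' & Eh' & <-).
      replace h' with h; auto. apply Hpsi, seg_eq. congruence.
    - exists (exist _ i Hi). intros x Hx. exfalso. eauto. }
  apply choice in Hg. destruct Hg as [g Hg].
  (* By cofinality [psi g] lies below some [f x], so [g] would differ from itself at [iota x]. *)
  destruct (Hcof _ (proj2_sig (psi g))) as [x Hx].
  exact (Hg (iota x) x eq_refl g Hx eq_refl).
Qed.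

(** [e b] names the points below [b] by ordinals below lambda. These names form the Ulam matrix and
    later locate codes. *)
Lemma seg_inj : exists e : K -> K -> K, (forall b x, x < b -> e b x < lam) /\
  (forall b x y, x < b -> y < b -> e b x = e b y -> x = y).
Proof.
  assert (H : forall b, exists e : K -> K, (forall x, x < b -> e x < lam) /\
    forall x y, x < b -> y < b -> e x = e y -> x = y).
  { intro b. destruct (HK_seg b) as [f Hf].
    exists (fun x => match excluded_middle_informative (x < b) with
      | left L => proj1_sig (f (exist _ x L)) | right _ => x end).
    split.
    - intros x L. destruct (excluded_middle_informative _); [apply proj2_sig|tauto].
    - intros x y Lx Ly.
      destruct (excluded_middle_informative (x < b)); [|tauto].
      destruct (excluded_middle_informative (y < b)); [|tauto].
      intro E. apply seg_eq, Hf in E. now injection E. }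
  apply choice in H. destruct H as [e He]. exists e.
  split; intros b; apply (He b).
Qed.

(** If [f] were unbounded, pick [g b] with [b < f (g b)]; then [b] is recovered from [g b] and its
    name below [f (g b)], so [K] embeds in [X * lambda]. *)
Lemma succ_regular (X : Type) (f : X -> K) : small X -> exists b, forall x, f x < b.
Proof.
  intro HX. apply NNPP. intro N. apply HK_big.
  destruct seg_inj as (e & He & Hi).
  assert (H : forall b, exists x, b < f x).
  { intro b. apply NNPP. intro N'. destruct (no_max b) as [c Lc]. apply N. exists c. intro x.
    assert (~ b < f x) by eauto. ord Hwo. }
  apply choice in H. destruct H as [g Hg].
  apply (card_le_trans _ (X * seg lt lam)).
  - exists (fun b => (g b, exist _ (e (f (g b)) b) (He _ _ (Hg b)))).
    intros b c E. injection E. intros E2 E1. rewrite <- E1 in E2.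
    apply Hi in E2; auto. now rewrite E1.
  - apply small_prod; auto. exists (fun x => x). auto.
Qed.

(** Points of [K] correspond to functions from lambda to lambda, so a function from [X] to [K]
    becomes one from [X * lambda] to lambda, and [X * lambda] embeds in lambda. *)
Lemma small_fun (X : Type) : small X -> card_le (X -> K) K.
Proof.
  intro HX. destruct Heq as (phi & Hphi & Hsur).
  assert (H : forall k, exists a, phi a = k) by auto.
  apply choice in H. destruct H as [kap Hkap].
  destruct (small_prod X (seg lt lam) HX (ex_intro _ (fun x => x) (fun _ _ E => E))) as [p Hp].
  assert (Hc : forall F : X -> K, exists u : seg lt lam -> seg lt lam,
    forall x z, u (p (x, z)) = kap (F x) z).
  { intro F.
    destruct (choice (fun y v => forall x z, y = p (x, z) -> v = kap (F x) z)) as [u Hu].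
    - intro y. destruct (classic (exists q, y = p q)) as [[[x z] E]|N].
      + exists (kap (F x) z). intros x' z' E'. rewrite E in E'. apply Hp in E'. congruence.
      + exists y. intros x z E. exfalso. eauto.
    - exists u. auto. }
  apply choice in Hc. destruct Hc as [c Hc]. exists (fun F => phi (c F)).
  intros F G E. apply Hphi in E. apply functional_extensionality. intro x.
  rewrite <- (Hkap (F x)), <- (Hkap (G x)). f_equal.
  apply functional_extensionality. intro z. now rewrite <- !Hc, E.
Qed.

Lemma small_seg x : small (seg lt x).
Proof. apply HK_seg. Qed.

Lemma small_sub (X Y : Type) (f : X -> Y) : (forall x y, f x = f y -> x = y) -> small Y -> small X.
Proof. intros Hf. apply card_le_trans. now exists f. Qed.

(** * Clubs *)

(** For unboundedness, iterate a common bound of the functions omega times and take the supremum. *)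
Lemma closure_club (X : Type) (F : X -> K -> K) : small X ->
  club lt (fun b => forall c, c < b -> forall x, F x c < b).
Proof.
  intro HX. split.
  - intro b0.
    assert (HB : forall c, exists d, forall x, F x c < d).
    { intro c. apply (succ_regular X (fun x => F x c) HX). }
    apply choice in HB. destruct HB as [B HB].
    assert (HG : forall c, exists d, c < d /\ forall b, b <= c -> B b < d).
    { intro c. destruct (no_max c) as [c' Lc].
      destruct (succ_regular _ (fun b : seg lt c' => B (proj1_sig b)) (small_seg c')) as [d Hd].
      destruct (classic (c < d)) as [L|L].
      - exists d. split; auto. intros b Lb. apply (Hd (exist _ b (le_lt_trans lt Hwo _ _ _ Lb Lc))).
      - exists c'. split; auto. intros b Lb.
        specialize (Hd (exist _ b (le_lt_trans lt Hwo _ _ _ Lb Lc))). simpl in Hd. ord Hwo. }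
    apply choice in HG. destruct HG as [G HG].
    set (h := fix h n := match n with O => b0 | S n => G (h n) end).
    destruct (succ_regular nat h nat_seg_lam) as [u Hu].
    destruct (least_upper lt Hwo (fun x => exists n, h n = x) u) as (s & Hs & _ & Hc).
    { intros x [n <-]. auto. }
    exists s. split; [|apply Hs; now exists 0].
    intros c L x. destruct (Hc c L) as (y & [n <-] & Hy).
    assert (L1 : F x c < B c) by auto.
    assert (L2 : B c < h (S n)) by (simpl; now apply HG).
    assert (L3 : h (S n) < s) by (apply Hs; now exists (S n)). ord Hwo.
  - intros b _ Hlim c L x. destruct (Hlim c L) as (g & Hg & L1 & L2).
    specialize (Hg c L1 x). ord Hwo.
Qed.

(** If [F x b] is an element of [D x] above [b], then a nonzero closure point of all the [F x] is a
    limit of every [D x]. *)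
Lemma inter_club (X : Type) (D : X -> K -> Prop) : small X -> (forall x, club lt (D x)) ->
  club lt (fun b => forall x, D x b).
Proof.
  intros HX HD. split.
  - intro b0.
    assert (H : forall x, exists F : K -> K, forall b, D x (F b) /\ b < F b).
    { intro x. destruct (HD x) as [H _]. exact (choice _ H). }
    apply choice in H. destruct H as [F HF].
    destruct (closure_club X F HX) as [Hu _]. destruct (Hu b0) as (b & Hb & L).
    exists b. split; auto. intro x. destruct (HD x) as [_ Hc]. apply Hc; eauto.
    intros c Lc. exists (F x c). destruct (HF x c). auto.
  - intros b Hn Hlim x. destruct (HD x) as [_ Hc]. apply Hc; auto.
    intros c Lc. destruct (Hlim c Lc) as (g & Hg & ?). exists g. auto.
Qed.

Lemma inter2_club D E : club lt D -> club lt E -> club lt (fun b => D b /\ E b).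
Proof.
  intros HD HE.
  assert (H : club lt (fun b => forall x : bool, if x then D b else E b)).
  { apply (inter_club bool (fun x b => if x then D b else E b)).
    - apply (small_sub bool nat (fun x => if x then 0 else 1)); [|apply nat_seg_lam].
      intros [|] [|]; congruence.
    - intros [|]; auto. }
  replace (fun b => D b /\ E b) with (fun b => forall x : bool, if x then D b else E b); auto.
  apply functional_extensionality. intro b. apply propositional_extensionality. split.
  - intro A. exact (conj (A true) (A false)).
  - intros [? ?] [|]; auto.
Qed.

(** In contrast to [acc], the limit point may lie outside [D]. *)
Definition limpt (D : K -> Prop) (a : K) : Prop :=
  (exists y, y < a) /\ forall b, b < a -> exists g, D g /\ b < g /\ g < a.

(** The cofinality of [a] is at least lambda. *)
Definition large_cof (a : K) : Prop :=
  forall i f, i < lam -> (forall j, j < i -> f j < a) ->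
  exists b, b < a /\ forall j, j < i -> f j < b.

(** Take the supremum of the first lambda terms of an increasing sequence in [D]; its cofinality
    comes from the regularity of lambda. *)
Lemma limpt_large_cof D : unbounded lt D -> exists a, limpt D a /\ large_cof a.
Proof.
  intro HD.
  destruct (wf_choice lt Hwo K (fun k f x => D x /\ forall j, j < k -> f j < x)) as [e He].
  - constructor; exact lam.
  - intros k f g E x (H & H'). split; auto. intros j L. rewrite <- E; auto.
  - intros k f _.
    destruct (succ_regular _ (fun j : seg lt k => f (proj1_sig j)) (small_seg k)) as [b Hb].
    destruct (HD b) as (x & Hx & L). exists x. split; auto. intros j Lj.
    specialize (Hb (exist _ j Lj)). simpl in Hb. ord Hwo.
  - destruct (succ_regular _ (fun j : seg lt lam => e (proj1_sig j)) (small_seg lam)) as [u Hu].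
    destruct (least_upper lt Hwo (fun x => exists i, i < lam /\ e i = x) u) as (a & Ha & _ & Hc).
    { intros x (i & L & <-). exact (Hu (exist _ i L)). }
    assert (Hea : forall i, i < lam -> e i < a) by eauto.
    exists a. split; [split|].
    + destruct Hsucc as (mu & L & _). eauto.
    + intros b L. destruct (Hc b L) as (x & (i & Li & <-) & Lb).
      destruct (lam_limit i Li) as (j & Lij & Lj). exists (e j).
      pose proof (proj2 (He j) i Lij). split; [apply He|split; auto]. ord Hwo.
    + intros i f Li Hf.
      assert (H : forall j : seg lt i, exists k, k < lam /\ f (proj1_sig j) <= e k).
      { intros [j Lj]. destruct (Hc _ (Hf j Lj)) as (x & (k & Lk & <-) & L). eauto. }
      apply choice in H. destruct H as [k Hk].
      destruct (lam_regular _ i k Li) as (b & Lb & Hb).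
      * exists (fun x => x). auto.
      * intro j. apply Hk.
      * exists (e b). split; auto. intros j Lj.
        destruct (Hk (exist _ j Lj)) as [_ L]. simpl in L.
        pose proof (proj2 (He b) _ (Hb (exist _ j Lj))). ord Hwo.
Qed.

(** Large cofinality gives [B] an element of index [t], so the supremum [b] of the elements of
    smaller index stays below [a]. Coherence at [b] will turn this initial segment into a full club
    of order type [t]. *)
Lemma club_in_enum B a t : large_cof a -> club_in lt B a -> t < lam -> limit lt t ->
  exists b, acc lt B b /\ exists h, enum lt (fun x => B x /\ x < b) t h.
Proof.
  intros Ha (Hlta & Hub & Hcl) Ht [[t0 Ht0] Htl].
  destruct (wf_choice lt Hwo K (fun k f x => k < lam ->
    B x /\ (forall j, j < k -> f j < x) /\ forall y, B y -> (forall j, j < k -> f j < y) -> x <= y))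
    as [e He].
  - constructor; exact lam.
  - intros k f g E x H L. destruct (H L) as (H1 & H2 & H3). repeat split; auto.
    + intros j Lj. rewrite <- E; auto.
    + intros y By Hy. apply H3; auto. intros j Lj. rewrite E; auto.
  - intros k f IH. destruct (classic (k < lam)) as [L|L]; [|exists k; tauto].
    destruct (Ha k f L) as (b & Lb & Hb).
    { intros j Lj. apply Hlta, IH; auto. ord Hwo. }
    destruct (Hub b Lb) as (g & Bg & Lg).
    destruct (least lt Hwo (fun x => B x /\ forall j, j < k -> f j < x)) as (x & (Bx & Hx) & Hmin).
    { exists g. split; auto. intros j Lj. specialize (Hb j Lj). ord Hwo. }
    exists x. intro. repeat split; auto.
  - assert (Hlam : forall k, k <= t -> k < lam) by (intros; ord Hwo).
    destruct (He t Ht) as (Bt & Ht1 & Ht2).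
    destruct (least_upper lt Hwo (fun x => exists i, i < t /\ e i = x) (e t)) as (s & Hs & Hle & Hc).
    { intros x (i & L & <-). auto. }
    assert (Hes : forall i, i < t -> e i < s) by eauto.
    assert (Hlim : forall c, c < s -> exists g, B g /\ c < g /\ g < s).
    { intros c L. destruct (Hc c L) as (x & (i & Li & <-) & Lb).
      destruct (Htl i Li) as (j & Lij & Lj).
      destruct (He j (Hlam j (lt_le lt j t Lj))) as (Bj & Hj & _).
      exists (e j). specialize (Hj i Lij). repeat split; auto. ord Hwo. }
    assert (Lsa : s < a) by (pose proof (Hlta _ Bt); ord Hwo).
    assert (Bs : B s) by (apply Hcl; eauto).
    exists s. split; [repeat split; eauto|].
    exists e. repeat split; auto.
    + apply He. ord Hwo.
    + intros i j Lij Lj. apply He; auto. ord Hwo.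
    + intros x (Bx & Lx). destruct (Hc x Lx) as (y & (i & Li & <-) & Lxy).
      destruct (least lt Hwo (fun i => i < t /\ x <= e i)) as (k & (Lk & Lxk) & Hmin); eauto.
      exists k. split; auto. apply (le_antisym lt Hwo); auto.
      apply He; auto; [ord Hwo|]. intros j Lj. apply (not_le lt Hwo). intro C.
      assert (k <= j); [|ord Hwo]. apply Hmin. split; auto. ord Hwo.
Qed.

(** * Squares and club guessing *)

Definition greatest (D : K -> Prop) (u x : K) : Prop :=
  D x /\ x <= u /\ forall y, D y -> y <= u -> y <= x.

(* The elements of C_a rounded down to D. If D is bounded in a, the tail of C_a above D is used
   instead, so that no limit point of it is a limit of D and coherence survives. *)
Definition drop (D : K -> Prop) (C : K -> K -> Prop) (a x : K) : Prop :=
  (limpt D a /\ exists u, C a u /\ greatest D u x) \/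
  (~ limpt D a /\ C a x /\ forall d, D d -> d < a -> d < x).

(** The supremum of [D] up to [u] is attained or a limit of [D], hence in [D] by closedness. *)
Lemma greatest_ex D d u : club lt D -> D d -> d <= u -> exists x, greatest D u x.
Proof.
  intros [_ Hcl] Dd Hd.
  destruct (least lt Hwo (fun s => forall y, D y -> y <= u -> y <= s)) as (s & Hs & Hmin).
  { exists u. auto. }
  exists s. split; [|split; auto].
  apply NNPP. intro N.
  assert (H : forall y, D y -> y <= u -> y < s).
  { intros y Dy Ly. destruct (Hs y Dy Ly) as [L| ->]; tauto. }
  apply N, Hcl; eauto. intros c Lc. apply NNPP. intro C.
  assert (s <= c); [|ord Hwo]. apply Hmin. intros y Dy Ly. apply (not_lt lt Hwo). intro L.
  apply C. eauto.
Qed.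

Lemma acc_mem C a b : club_in lt (C a) a -> b < a -> limpt (C a) b -> C a b.
Proof. intros (_ & _ & H) L [Hn Hl]. auto. Qed.

(** As [y] is in [D], [y <= u] would force [y <= x]. So rounded points interleave with their
    origins: [x <= u < y <= v]. *)
Lemma greatest_lt D u v x y : greatest D u x -> greatest D v y -> x < y -> u < y.
Proof.
  intros (_ & _ & H) (Dy & _) L. apply (not_le lt Hwo). intro C. specialize (H y Dy C). ord Hwo.
Qed.

Lemma greatest_mono D u v x y : greatest D u x -> greatest D v y -> x < y -> u < v.
Proof.
  intros H H' L. pose proof (greatest_lt _ _ _ _ _ H H' L). destruct H' as (_ & ? & _). ord Hwo.
Qed.

(** By the interleaving, each rounded point is followed by a point of [C a] before the next rounded
    one; rounded points are themselves in [D]. *)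
Lemma drop_limpt D C a b : limpt D a -> limpt (drop D C a) b -> limpt D b /\ limpt (C a) b.
Proof.
  intros HDa [Hn Hl].
  assert (Hl' : forall c, c < b -> exists x u, C a u /\ greatest D u x /\ c < x /\ x < b).
  { intros c Lc. destruct (Hl c Lc) as (g & [(_ & u & Cu & Hg)|[]] & L); [|tauto].
    exists g, u. tauto. }
  split; split; auto; intros c Lc; destruct (Hl' c Lc) as (x & u & Cu & Hx & L1 & L2).
  - exists x. destruct Hx as [Hx _]. auto.
  - destruct (Hl' x L2) as (y & v & Cv & Hy & L3 & L4).
    pose proof (greatest_lt _ _ _ _ _ Hx Hy L3). exists u. destruct Hx as (_ & ? & _).
    repeat split; auto; ord Hwo.
Qed.

Lemma drop_low D C a b : ~ limpt D a -> limpt (drop D C a) b -> b <= a ->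
  limpt (C a) b /\ ~ limpt D b /\ exists x, x < b /\ forall d, D d -> d < a -> d < x.
Proof.
  intros HDa [Hn Hl] Hba.
  assert (Hl' : forall c, c < b -> exists x, C a x /\ (forall d, D d -> d < a -> d < x) /\
    c < x /\ x < b).
  { intros c Lc. destruct (Hl c Lc) as (g & [[]|(_ & Cg & Hg)] & L); [tauto|]. exists g. tauto. }
  destruct Hn as [y0 Hy0]. destruct (Hl' y0 Hy0) as (x & Cx & Hx & L1 & L2).
  split; [|split; eauto].
  - split; eauto. intros c Lc. destruct (Hl' c Lc) as (y & ? & _ & ?). eauto.
  - intros [_ HDb]. destruct (HDb x L2) as (d & Dd & L3 & L4).
    assert (La : d < a) by ord Hwo. specialize (Hx d Dd La). ord Hwo.
Qed.

(** A limit point [b] of the dropped set falls under the same clause of [drop] as [a], so coherence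
    reduces to that of [C]. *)
Lemma drop_square D C : club lt D -> is_square lt lam C -> is_square lt lam (drop D C).
Proof.
  intros HD HC a Ha. destruct (HC a Ha) as (Hclub & Hotp & Hcoh).
  destruct Hclub as (Hb & Hu & Hcl). apply (otp_le_fun lt) in Hotp. destruct Hotp as (f & Hf & Hm).
  destruct (classic (limpt D a)) as [HDa|HDa].
  - assert (Hgr : forall x, drop D C a x -> exists u, C a u /\ greatest D u x).
    { intros x [H|H]; tauto. }
    split; [split; [|split]|split].
    + intros x Hx. destruct (Hgr x Hx) as (u & Cu & _ & L & _). specialize (Hb u Cu). ord Hwo.
    + intros b L. destruct HDa as [? HDa]. destruct (HDa b L) as (d & Dd & L1 & L2).
      destruct (Hu d L2) as (u & Cu & L3).
      destruct (greatest_ex D d u HD Dd (lt_le lt _ _ L3)) as (x & Hx).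
      exists x. split; [left; split; [split|]; eauto|]. destruct Hx as (_ & _ & Hx).
      specialize (Hx d Dd (lt_le lt _ _ L3)). ord Hwo.
    + intros b L Hn Hl. left. split; auto.
      destruct (drop_limpt D C a b HDa (conj Hn Hl)) as [HDb HCb].
      exists b. split; [apply Hcl; auto; apply HCb|]. split; [apply HD; auto; apply HDb|].
      split; [apply le_refl|auto].
    (* Choosing for each rounded point one [u] that rounds to it embeds the new set in [C a],
       preserving order. *)
    + apply (otp_le_fun lt).
      destruct (choice (fun x u => drop D C a x -> C a u /\ greatest D u x)) as [g Hg].
      { intro x. destruct (classic (drop D C a x)) as [H|H]; [|exists x; tauto].
        destruct (Hgr x H) as [u Hu']. exists u. auto. }
      exists (fun x => f (g x)). split.
      * intros x Hx. apply Hf, Hg, Hx.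
      * intros x y Hx Hy L. destruct (Hg x Hx) as [Cx Gx], (Hg y Hy) as [Cy Gy].
        apply Hm; auto. eapply greatest_mono; eassumption.
    + intros b (Bb & Hn & Hl) x.
      destruct (drop_limpt D C a b HDa (conj Hn Hl)) as [HDb HCb].
      assert (Lba : b < a). { destruct (Hgr b Bb) as (u & Cu & _ & L & _). specialize (Hb u Cu). ord Hwo. }
      assert (Cb : forall x, C b x <-> C a x /\ x < b).
      { apply Hcoh. destruct HCb. split; auto. }
      split.
      * intros [(_ & u & Cu & Hx)|[]]; [|tauto]. apply Cb in Cu. destruct Cu as [Cu Lu].
        split; [left; eauto|]. destruct Hx as (_ & ? & _). ord Hwo.
      * intros [Bx Lx]. destruct (Hgr x Bx) as (u & Cu & Gu).
        destruct (Hl x Lx) as (y & By & L1 & L2). destruct (Hgr y By) as (v & Cv & Gv).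
        pose proof (greatest_lt _ _ _ _ _ Gu Gv L1).
        left. split; auto. exists u. split; auto. apply Cb. split; auto. ord Hwo.
  - split; [split; [|split]|split].
    + intros x [[]|(_ & Cx & _)]; [tauto|auto].
    + intros b L.
      (* [D] is bounded in [a] by some [c], and the points of [C a] above [c] satisfy the second
         clause of [drop]. *)
      assert (H : exists c, c < a /\ forall d, D d -> d < a -> d <= c).
      { apply NNPP. intro N. apply HDa. split; eauto. intros c Lc. apply NNPP. intro N'.
        apply N. exists c. split; auto. intros d Dd Ld. apply (not_lt lt Hwo). intro. apply N'. eauto. }
      destruct H as (c & Lc & Hc).
      assert (H : exists m, b <= m /\ c <= m /\ m < a).
      { destruct (classic (b < c)); [exists c|exists b]; repeat split; auto; try apply le_refl; ord Hwo. }
      destruct H as (m & ? & ? & Lm). destruct (Hu m Lm) as (x & Cx & Lx).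
      exists x. split; [right; split; [auto|split; [auto|]]|ord Hwo].
      intros d Dd Ld. specialize (Hc d Dd Ld). ord Hwo.
    + intros b L Hn Hl.
      destruct (drop_low D C a b HDa (conj Hn Hl) (lt_le lt _ _ L)) as (HCb & _ & x & Lx & Hx).
      right. repeat split; auto; [apply Hcl; auto; apply HCb|].
      intros d Dd Ld. specialize (Hx d Dd Ld). ord Hwo.
    + apply (otp_le_fun lt). exists f. split.
      * intros x [[]|(_ & Cx & _)]; [tauto|auto].
      * intros x y [[]|(_ & Cx & _)] [[]|(_ & Cy & _)]; try tauto. auto.
    + intros b (Bb & Hn & Hl) x.
      assert (Lba : b < a) by (destruct Bb as [[]|(_ & Cb & _)]; [tauto|auto]).
      destruct (drop_low D C a b HDa (conj Hn Hl) (lt_le lt _ _ Lba)) as (HCb & HDb & y & Ly & Hy).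
      assert (Cb : forall x, C b x <-> C a x /\ x < b).
      { apply Hcoh. destruct HCb. split; auto. }
      split.
      * intros [[]|(_ & Cx & Hx)]; [tauto|]. apply Cb in Cx. destruct Cx as [Cx Lx].
        split; auto. right. repeat split; auto. intros d Dd Ld. apply Hx; auto.
        specialize (Hy d Dd Ld). ord Hwo.
      * intros [[[]|(_ & Cx & Hx)] Lx]; [tauto|]. right. split; auto. split; [now apply Cb|].
        intros d Dd Ld. apply Hx; auto. ord Hwo.
Qed.

Definition guesses (t : K) (C : K -> K -> Prop) : Prop :=
  forall E, club lt E -> exists a, limit lt a /\ otp_eq lt (C a) t /\ forall x, C a x -> E x.

Lemma limpt_limit D a : limpt D a -> limit lt a.
Proof.
  intros [H1 H2]. split; auto. intros y L. destruct (H2 y L) as (g & _ & H). eauto.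
Qed.

Lemma greatest_unique D u x y : greatest D u x -> greatest D u y -> x = y.
Proof.
  intros (Dx & Lx & Hx) (Dy & Ly & Hy). apply (le_antisym lt Hwo); auto.
Qed.

(* The greatest elements below [u] decrease with [j], hence stabilise. *)
Lemma greatest_stable (D : K -> K -> Prop) u :
  (forall i, club lt (D i)) -> (forall i j, i <= j -> forall x, D j x -> D i x) ->
  exists i, i < lam /\ forall j, i <= j -> j < lam -> forall x,
    greatest (D j) u x <-> greatest (fun y => forall i, i < lam -> D i y) u x.
Proof.
  intros HD Hdec.
  (* If some [D i] has no point up to [u], neither have the later ones nor the intersection, and
     both sides are false. *)
  destruct (classic (exists j, j < lam /\ forall y, D j y -> ~ y <= u)) as [(i & Li & Hi)|N].
  - exists i. split; auto. intros j Lij Lj x. split; intros (Dx & Lx & _); exfalso.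
    + apply (Hi x); auto. eapply Hdec; eassumption.
    + apply (Hi x); auto.
  - assert (Hex : forall j, j < lam -> exists v, greatest (D j) u v).
    { intros j Lj. apply NNPP. intro C. apply N. exists j. split; auto. intros y Dy Ly.
      apply C. eapply greatest_ex; eauto. }
    destruct (least lt Hwo (fun v => exists j, j < lam /\ greatest (D j) u v))
      as (v & (i & Li & Hv) & Hmin).
    { destruct Hsucc as (mu & L & _). destruct (Hex mu L). eauto. }
    assert (Hst : forall j, i <= j -> j < lam -> greatest (D j) u v).
    { intros j Lij Lj. destruct (Hex j Lj) as [w Hw]. replace v with w; auto.
      apply (le_antisym lt Hwo); [|apply Hmin; eauto].
      destruct Hw as (Dw & Lw & _). apply Hv; eauto. }
    assert (Hin : greatest (fun y => forall i, i < lam -> D i y) u v).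
    { split; [|split].
      - intros k Lk. destruct (classic (k < i)) as [L|L].
        + apply (Hdec k i); [now left|]. apply Hv.
        + apply (Hst k); auto. ord Hwo.
      - apply Hv.
      - intros y Hy Ly. apply Hv; auto. }
    exists i. split; auto. intros j Lij Lj x. specialize (Hst j Lij Lj).
    split; intro H.
    + now rewrite (greatest_unique _ _ _ _ H Hst).
    + now rewrite (greatest_unique _ _ _ _ H Hin).
Qed.

Lemma drop_guesses C t : is_square lt lam C -> t < lam -> limit lt t ->
  exists D, club lt D /\ guesses t (drop D C).
Proof.
  intros HC Lt Ht. apply NNPP. intro N.
  (* [E D] is a club that [drop D C] fails to guess; [D k] below will be the intersection of all
     earlier clubs and their counterexamples. *)
  assert (HE : forall D, exists E, club lt D -> club lt E /\
    forall a, limit lt a -> otp_eq lt (drop D C a) t -> exists x, drop D C a x /\ ~ E x).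
  { intro D. destruct (classic (club lt D)) as [HD|HD]; [|exists D; tauto].
    apply NNPP. intro N'. apply N. exists D. split; auto. intros E HE.
    apply NNPP. intro N''. apply N'. exists E. intros _. split; auto.
    intros a La Ha. apply NNPP. intro N3. apply N''. exists a. split; [|split]; auto.
    intros x Hx. apply NNPP. eauto. }
  apply choice in HE. destruct HE as [E HE].
  destruct (wf_choice lt Hwo (K -> Prop)
    (fun k f X => forall x, X x <-> forall j, j < k -> f j x /\ E (f j) x)) as [D HD].
  - constructor. exact (fun _ => True).
  - intros k f g Hfg X HX x. rewrite (HX x).
    split; intros H j L; specialize (H j L); [rewrite <- Hfg|rewrite Hfg]; auto.
  - intros k f _. exists (fun x => forall j, j < k -> f j x /\ E (f j) x). tauto.
  - assert (HDclub : forall k, club lt (D k)).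
    { intro k. destruct Hwo as (Hw & _). induction (Hw k) as [k _ IH].
      replace (D k) with (fun b => forall j : seg lt k, D (proj1_sig j) b /\ E (D (proj1_sig j)) b).
      - apply inter_club; [apply small_seg|]. intros [j L].
        apply inter2_club; simpl; [|apply HE]; auto.
      - apply functional_extensionality. intro x. apply propositional_extensionality.
        rewrite (HD k x). split; intro H.
        + intros j L. exact (H (exist _ j L)).
        + intros [j L]. exact (H j L). }
    assert (Hdec : forall i j, i <= j -> forall x, D j x -> D i x).
    { intros i j Lij x. rewrite (HD j x), (HD i x). intros H k L. apply H. ord Hwo. }
    set (Dinf := fun y => forall i, i < lam -> D i y).
    assert (HDinf : club lt Dinf).
    { replace Dinf with (fun b => forall j : seg lt lam, D (proj1_sig j) b).
      - apply inter_club; [apply small_seg|]. auto.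
      - apply functional_extensionality. intro x. apply propositional_extensionality.
        split; intro H.
        + intros j L. exact (H (exist _ j L)).
        + intros [j L]. exact (H j L). }
    destruct (limpt_large_cof Dinf (proj1 HDinf)) as (a & HDa & Hcof).
    pose proof (limpt_limit _ _ HDa) as Ha.
    destruct (drop_square Dinf C HDinf HC a Ha) as (Hclub & _ & Hcoh).
    destruct (club_in_enum _ a t Hcof Hclub Lt Ht) as (b & Hb & h & Hh).
    assert (Lba : b < a) by (apply Hclub, Hb).
    destruct (drop_limpt Dinf C a b HDa (proj2 Hb)) as [HDb HCb].
    destruct (HC a Ha) as (HCclub & Hotp & HCcoh). apply (otp_le_fun lt) in Hotp.
    destruct Hotp as (f & Hf & Hm).
    assert (Cb : forall x, C b x <-> C a x /\ x < b).
    { apply HCcoh. split; [|exact HCb]. now apply acc_mem. }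
    destruct HCclub as (_ & Hu & _). destruct (Hu b Lba) as (u0 & Cu0 & Lu0).
    assert (Hst : forall u : {u | C b u}, exists i, i < lam /\ forall j, i <= j -> j < lam -> forall x,
      greatest (D j) (proj1_sig u) x <-> greatest Dinf (proj1_sig u) x).
    { intro u. now apply greatest_stable. }
    apply choice in Hst. destruct Hst as [g Hg].
    (* As [b < a], the set [C b] embeds in [f u0 < lambda]; by regularity one [i] bounds all stages
       at which its points stabilise. *)
    destruct (lam_regular _ (f u0) g (Hf u0 Cu0)) as (i & Li & Hi).
    { assert (H : forall u, C b u -> f u < f u0).
      { intros u Cu. apply Cb in Cu. destruct Cu. apply Hm; auto. ord Hwo. }
      exists (fun u => exist _ (f (proj1_sig u)) (H _ (proj2_sig u))).
      intros [u Cu] [v Cv]. simpl. intro Euv. injection Euv. clear Euv. intro Euv.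
      assert (Eq : u = v).
      { apply Cb in Cu, Cv. destruct Cu, Cv, Hwo as (_ & _ & Htot).
        destruct (Htot u v) as [L|[L|L]]; auto; exfalso; apply Hm in L; auto;
          rewrite Euv in L; now apply (lt_irrefl lt Hwo) in L. }
      subst v. f_equal. apply proof_irrelevance. }
    { apply Hg. }
    (* So [D i] already rounds [C b] as [Dinf] does, and coherence at [b] makes the result an
       initial segment, of order type [t]. *)
    assert (Hdrop : drop (D i) C b = fun x => drop Dinf C a x /\ x < b).
    { apply functional_extensionality. intro x. apply propositional_extensionality.
      rewrite <- (Hcoh b Hb x).
      assert (HDib : limpt (D i) b).
      { destruct HDb as [Hn HDb]. split; auto. intros c Lc.
        destruct (HDb c Lc) as (y & Hy & L). exists y. split; auto. }
      assert (Hiff : forall u, C b u -> (greatest (D i) u x <-> greatest Dinf u x)).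
      { intros u Cu. apply (proj2 (Hg (exist _ u Cu))); auto. now left. }
      unfold drop. split.
      - intros [(_ & u & Cu & H)|[]]; [|tauto]. left. split; auto. exists u. split; auto.
        now apply Hiff.
      - intros [(_ & u & Cu & H)|[]]; [|tauto]. left. split; auto. exists u. split; auto.
        now apply Hiff. }
    destruct (HE (D i) (HDclub i)) as [_ HEi].
    destruct (HEi b) as (x & Hx & Nx).
    + apply (limpt_limit _ _ HDb).
    + rewrite Hdrop. apply (otp_eq_enum lt Hwo). eauto.
    + rewrite Hdrop in Hx. destruct Hx as [[(_ & u & Cu & Dx & _)|[]] _]; [|tauto].
      (* [x] is in [Dinf], hence in [D i'] with [i < i'], hence in [E (D i)]. *)
      destruct (lam_limit i Li) as (i' & L & L').
      apply Nx. apply (proj1 (HD i' x)); auto.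
Qed.

(** The intersection [D'] of the clubs for the single [t] serves them all: when the set dropped to
    [Dt] lies inside [D'], dropping to [D'] gives the same set. *)
Lemma square_guesses C : is_square lt lam C ->
  exists C', is_square lt lam C' /\ forall t, t < lam -> limit lt t -> guesses t C'.
Proof.
  intro HC.
  assert (H : forall t : seg lt lam, exists D, club lt D /\
    (limit lt (proj1_sig t) -> guesses (proj1_sig t) (drop D C))).
  { intros [t L]. simpl. destruct (classic (limit lt t)) as [Ht|Ht].
    - destruct (drop_guesses C t HC L Ht) as (D & ? & ?). eauto.
    - exists (fun _ => True). split; [|tauto]. split; auto. intro b.
      destruct (no_max b). eauto. }
  apply choice in H. destruct H as [D HD].
  set (D' := fun x => forall t, D t x).
  assert (HD' : club lt D') by (apply inter_club; [apply small_seg|apply HD]).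
  exists (drop D' C). split; [now apply drop_square|].
  intros t L Ht E HE. destruct (HD (exist _ t L)) as [HDt Hg]. simpl in Hg.
  specialize (Hg Ht). destruct (Hg (fun x => E x /\ D' x)) as (a & Ha & Hotp & Hsub).
  { now apply inter2_club. }
  set (Dt := D (exist (fun x => x < lam) t L)) in *.
  destruct (drop_square Dt C HDt HC a Ha) as ((Hlta & Hub & _) & _ & _).
  assert (Hlim : limpt D' a).
  { destruct Ha as [Hn _]. split; auto. intros b Lb. destruct (Hub b Lb) as (g & Hg' & Lg).
    exists g. split; [apply Hsub, Hg'|auto]. }
  assert (Hlimt : limpt Dt a).
  { destruct Hlim as [Hn Hl]. split; auto. intros b Lb. destruct (Hl b Lb) as (g & Hg' & Lg).
    exists g. split; auto. apply Hg'. }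
  assert (Heqd : drop D' C a = drop Dt C a).
  { apply functional_extensionality. intro x. apply propositional_extensionality.
    assert (Hx : forall u, C a u -> greatest Dt u x -> greatest D' u x).
    { intros u Cu Hx. destruct (Hsub x) as [_ D'x]; [left; eauto|].
      destruct Hx as (_ & ? & Hmax). split; [|split]; auto.
      intros y Dy. apply Hmax. apply Dy. }
    split.
    - intros [(_ & u & Cu & H)|[]]; [|tauto]. left. split; auto. exists u. split; auto.
      destruct (greatest_ex Dt x u HDt) as [y Hy].
      + apply H.
      + apply H.
      + pose proof (Hsub y) as Hsy. destruct Hsy as [_ D'y]; [left; eauto|].
        assert (Hy' : greatest D' u y).
        { destruct Hy as (_ & ? & Hmax). split; [|split]; auto.
          intros z Dz. apply Hmax. apply Dz. }
        now rewrite (greatest_unique _ _ _ _ H Hy').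
    - intros [(_ & u & Cu & H)|[]]; [|tauto]. left. split; auto. exists u. auto. }
  exists a. rewrite Heqd. split; [|split]; auto. intros x Hx. now apply Hsub.
Qed.

(** * Prescribing a colour to the least element of the club *)

Definition least_in (A : K -> Prop) (m : K) : Prop := A m /\ forall x, A x -> m <= x.

(** An analogue of stationarity of [Z], tested on the least elements of guessing sets of order type
    [t]. *)
Definition positive (C : K -> K -> Prop) (t : K) (Z : K -> Prop) : Prop :=
  forall E, club lt E -> exists a, limit lt a /\ otp_eq lt (C a) t /\
    (forall x, C a x -> E x) /\ exists m, least_in (C a) m /\ Z m.

Lemma above_club (b0 : K) : club lt (fun b => b0 < b).
Proof.
  split.
  - intro b. destruct (no_max b) as [c Lc], (no_max b0) as [c0 Lc0].
    destruct (classic (c < c0)); [exists c0|exists c]; split; auto; ord Hwo.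
  - intros b [y Hy] Hl. destruct (Hl y Hy) as (g & Lg & _ & L). ord Hwo.
Qed.

(* An Ulam matrix argument: otherwise, for lambda many [x] and almost all [b > x], the value [e b x]
   would lie below a fixed [r < lambda]. *)
Lemma positive_colour C e :
  (forall b x, x < b -> e b x < lam) ->
  (forall b x y, x < b -> y < b -> e b x = e b y -> x = y) ->
  (forall t, t < lam -> limit lt t -> guesses t C) ->
  exists x, forall t r, t < lam -> limit lt t -> r < lam ->
    exists s, r <= s /\ s < lam /\ positive C t (fun b => x < b /\ e b x = s).
Proof.
  intros He Hinj HC. apply NNPP. intro N.
  assert (H : forall x, exists p : seg lt lam * seg lt lam, limit lt (proj1_sig (fst p)) /\
    forall s, proj1_sig (snd p) <= s -> s < lam ->
      ~ positive C (proj1_sig (fst p)) (fun b => x < b /\ e b x = s)).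
  { intro x. apply NNPP. intro N'. apply N. exists x. intros t r Lt Ht Lr.
    apply NNPP. intro N''. apply N'. exists (exist _ t Lt, exist _ r Lr). simpl. split; auto.
    intros s Ls1 Ls2 Hp. apply N''. eauto. }
  apply choice in H. destruct H as [G HG].
  assert (Hp : exists p, unbounded lt (fun x => G x = p)).
  { apply NNPP. intro N'.
    assert (H : forall p, exists b, forall x, G x = p -> x <= b).
    { intro p. apply NNPP. intro N''. apply N'. exists p. intro b. apply NNPP. intro N3.
      apply N''. exists b. intros x Hx. apply (not_lt lt Hwo). intro. apply N3. eauto. }
    apply choice in H. destruct H as [B HB].
    destruct (succ_regular _ B (small_prod _ _ (small_seg lam) (small_seg lam))) as [b Hb].
    pose proof (HB (G b) b eq_refl). specialize (Hb (G b)). ord Hwo. }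
  destruct Hp as [p Hp].
  assert (Hh : exists h : seg lt lam -> K, (forall i j, h i = h j -> i = j) /\ forall i, G (h i) = p).
  { assert (H : card_le (seg lt lam) {x | G x = p}).
    { destruct (card_compare lt Hwo {x | G x = p}) as [C'|[k C']].
      - destruct (Hp lam) as (x & Hx & _). constructor. now exists x.
      - eapply card_le_trans; [|exact C']. exists (fun x => proj1_sig x). apply seg_eq.
      - exfalso. assert (Hs : small {x | G x = p}) by (eapply card_le_trans; [exact C'|apply HK_seg]).
        destruct (succ_regular _ (fun x => proj1_sig x) Hs) as [b Hb].
        destruct (Hp b) as (x & Hx & L). specialize (Hb (exist _ x Hx)). simpl in Hb. ord Hwo. }
    destruct H as [h Hh]. exists (fun i => proj1_sig (h i)). split.
    - intros i j E. apply Hh. destruct (h i), (h j). simpl in E. subst. f_equal.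
      apply proof_irrelevance.
    - intro i. apply proj2_sig. }
  destruct Hh as (h & Hhinj & HGh).
  destruct p as [[t Lt] [r Lr]].
  assert (Ht : limit lt t) by (destruct (HG (h (exist _ t Lt))) as [Ht _]; now rewrite HGh in Ht).
  assert (HE : forall q : seg lt lam * seg lt lam, exists E, club lt E /\
    (r <= proj1_sig (snd q) -> forall a, limit lt a -> otp_eq lt (C a) t -> (forall x, C a x -> E x) ->
      forall m, least_in (C a) m -> ~ (h (fst q) < m /\ e m (h (fst q)) = proj1_sig (snd q)))).
  { intros [i [s Ls]]. simpl. destruct (classic (r <= s)) as [L|L].
    - destruct (HG (h i)) as [_ H]. rewrite HGh in H. specialize (H s L Ls). simpl in H.
      apply not_all_ex_not in H. destruct H as [E HE]. apply imply_to_and in HE.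
      exists E. split; [tauto|]. intros _ a Ha Hotp Hsub m Hm HZ. apply HE. exists a. eauto 6.
    - exists (fun _ => True). split; [|tauto]. split; auto. intro b. destruct (no_max b). eauto. }
  apply choice in HE. destruct HE as [E HE].
  destruct (succ_regular _ h (small_seg lam)) as [b0 Hb0].
  destruct (HC t Lt Ht (fun b => (forall q, E q b) /\ b0 < b)) as (a & Ha & Hotp & Hsub).
  { apply inter2_club; [|apply above_club].
    apply inter_club; [apply small_prod; apply small_seg|apply HE]. }
  destruct (least lt Hwo (C a)) as (m & Cm & Hm).
  { apply (otp_eq_enum lt Hwo) in Hotp. destruct Hotp as (k & Hk & _).
    destruct Ht as [[t0 Ht0] _]. eauto. }
  destruct (Hsub m Cm) as [_ Lm].
  assert (Lh : forall i, h i < m) by (intro i; specialize (Hb0 i); ord Hwo).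
  (* At the minimum [m] of a guess inside all these clubs, sending [i] to [e m (h i)] injects lambda
     into [r]. *)
  apply (seg_small r Lr).
  assert (Hlow : forall i, e m (h i) < r).
  { intro i. apply (not_le lt Hwo). intro L.
    destruct (HE (i, exist _ (e m (h i)) (He _ _ (Lh i)))) as [_ H]. simpl in H.
    apply (H L a Ha Hotp) with (m := m); auto.
    - intros x Cx. now apply Hsub.
    - split; auto. }
  exists (fun i => exist _ (e m (h i)) (Hlow i)). intros i j Eij. injection Eij. intro Eij'.
  apply Hhinj. apply (Hinj m); auto.
Qed.

(** Fix [x] as in [positive_colour]; the freedom in [s >= r] lets [f t] be chosen strictly
    increasing, with the points where [e b x = f t] positive for limit [t]. The colour of [b] is
    then read off from [e b x]. *)
Lemma colouring C : (forall t, t < lam -> limit lt t -> guesses t C) ->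
  exists c : K -> K, forall t, t < lam -> limit lt t -> positive C t (fun b => c b = t).
Proof.
  intro HC. destruct seg_inj as (e & He & Hinj).
  destruct (positive_colour C e He Hinj HC) as [x Hx].
  destruct (wf_choice lt Hwo K (fun t f s => t < lam -> s < lam /\ (forall u, u < t -> f u < s) /\
    (limit lt t -> positive C t (fun b => x < b /\ e b x = s)))) as [f Hf].
  - constructor. exact lam.
  - intros k f g E s H L. destruct (H L) as (H1 & H2 & H3). split; [|split]; auto.
    intros u Lu. rewrite <- E; auto.
  - intros t f IH. destruct (classic (t < lam)) as [Lt|]; [|exists t; tauto].
    destruct (lam_regular (seg lt t) t (fun u => f (proj1_sig u)) Lt) as (r & Lr & Hr).
    + exists (fun u => u). auto.
    + intros [u Lu]. simpl. apply IH; auto. ord Hwo.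
    + destruct (classic (limit lt t)) as [Ht|Ht].
      * destruct (Hx t r Lt Ht Lr) as (s & Lrs & Ls & Hs). exists s. intros _.
        split; [|split]; auto. intros u Lu. specialize (Hr (exist _ u Lu)). simpl in Hr. ord Hwo.
      * exists r. intros _. split; [|split]; auto; [|tauto].
        intros u Lu. apply (Hr (exist _ u Lu)).
  - destruct (choice (fun b u => forall t, t < lam -> e b x = f t -> u = t)) as [c Hc].
    { intro b. destruct (classic (exists t, t < lam /\ e b x = f t)) as [(t & Lt & Et)|N].
      - exists t. intros t' Lt' Et'. rewrite Et in Et'. clear Et. destruct Hwo as (_ & _ & Htot).
        destruct (Htot t t') as [L|[L|L]]; auto; exfalso; eapply (lt_irrefl lt Hwo).
        + pose proof (proj1 (proj2 (Hf t' Lt')) _ L) as H. rewrite Et' in H. exact H.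
        + pose proof (proj1 (proj2 (Hf t Lt)) _ L) as H. rewrite Et' in H. exact H.
      - exists b. intros t Lt Et. exfalso. eauto. }
    exists c. intros t Lt Ht E HE. destruct (Hf t Lt) as (_ & _ & H).
    destruct (H Ht E HE) as (a & Ha & Hotp & Hsub & m & Hm & _ & Em).
    exists a. split; [|split; [|split]]; auto. exists m. auto.
Qed.

(** * Moving successor elements of the clubs *)

(** Vacuously true of the empty set, so [T_no_last] fixes the least element of a club as well as its
    limit elements. *)
Definition no_last (S : K -> Prop) : Prop := forall x, S x -> exists y, S y /\ x < y.
Definition last_in (S : K -> Prop) (b : K) : Prop := S b /\ forall x, S x -> x <= b.
Definition below (A : K -> Prop) (u x : K) : Prop := A x /\ x < u.

(** [T] sees only [u] and the part of the club below it, so the shifts of coherent clubs cohere. *)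
Definition shift (T : (K -> Prop) -> K -> K) (C : K -> K -> Prop) (a x : K) : Prop :=
  exists u, C a u /\ x = T (below (C a) u) u.

Section Shift.
Context (T : (K -> Prop) -> K -> K)
  (T_no_last : forall S u, no_last S -> T S u = u)
  (T_last : forall S u b, last_in S b -> b < u -> b < T S u /\ T S u <= u).

Lemma last_or_no_last S : (exists b, last_in S b) \/ no_last S.
Proof.
  destruct (classic (exists b, last_in S b)) as [|N]; auto. right. intros x Hx.
  apply NNPP. intro N'. apply N. exists x. split; auto. intros y Hy.
  apply (not_lt lt Hwo). intro. eauto.
Qed.

Lemma shift_le A u : T (below A u) u <= u.
Proof.
  destruct (last_or_no_last (below A u)) as [[b Hb]|H].
  - apply (T_last _ _ b); auto. apply Hb.
  - rewrite T_no_last; auto. apply le_refl.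
Qed.

(** With [shift_le] this gives the same interleaving as for [drop]: each new place lies above all
    earlier old ones and at most at its own. *)
Lemma shift_gt A u v : A v -> v < u -> v < T (below A u) u.
Proof.
  intros Av L. destruct (last_or_no_last (below A u)) as [[b Hb]|H].
  - destruct (T_last _ u b Hb); [apply Hb|]. destruct Hb as [_ Hb].
    assert (v <= b) by (apply Hb; split; auto). ord Hwo.
  - rewrite T_no_last; auto.
Qed.

Lemma shift_mono A u v : A v -> v < u -> T (below A v) v < T (below A u) u.
Proof. intros Av L. pose proof (shift_gt A u v Av L). pose proof (shift_le A v). ord Hwo. Qed.

Lemma shift_mono_inv A u v : A u -> A v ->
  T (below A v) v < T (below A u) u -> v < u.
Proof.
  intros Au Av L. apply (not_le lt Hwo). intros [L'| ->]; [|ord Hwo].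
  pose proof (shift_mono A v u Au L'). ord Hwo.
Qed.

Lemma shift_limpt C a b : limpt (shift T C a) b -> limpt (C a) b.
Proof.
  intros [Hn Hl]. split; auto. intros c Lc.
  destruct (Hl c Lc) as (x & (u & Cu & ->) & L1 & L2).
  destruct (Hl _ L2) as (y & (v & Cv & ->) & L3 & L4).
  pose proof (shift_gt (C a) v u Cu (shift_mono_inv (C a) v u Cv Cu L3)).
  pose proof (shift_le (C a) u). exists u. repeat split; auto; ord Hwo.
Qed.

Lemma shift_square C : is_square lt lam C -> is_square lt lam (shift T C).
Proof.
  intros HC a Ha. destruct (HC a Ha) as ((Hb & Hu & Hcl) & Hotp & Hcoh).
  apply (otp_le_fun lt) in Hotp. destruct Hotp as (f & Hf & Hm).
  split; [split; [|split]|split].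
  - intros x (u & Cu & ->). specialize (Hb u Cu). pose proof (shift_le (C a) u). ord Hwo.
  - intros b L. destruct (Hu b L) as (u & Cu & Lu). destruct (Hu u (Hb u Cu)) as (v & Cv & Lv).
    exists (T (below (C a) v) v). split; [exists v; auto|].
    pose proof (shift_gt (C a) v u Cu Lv). ord Hwo.
  (* A limit point of the shifted set is a limit of [C a], where [T] moves nothing. *)
  - intros b L Hn Hl. destruct (shift_limpt C a b (conj Hn Hl)) as [_ HCb].
    exists b. split; [apply Hcl; auto|]. symmetry. apply T_no_last.
    intros x [Cx Lx]. destruct (HCb x Lx) as (y & Cy & L1 & L2). exists y. split; [split|]; auto.
  - apply (otp_le_fun lt).
    destruct (choice (fun x u => shift T C a x -> C a u /\ x = T (below (C a) u) u)) as [g Hg].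
    { intro x. destruct (classic (shift T C a x)) as [[u H]|H]; [exists u|exists x]; tauto. }
    exists (fun x => f (g x)). split.
    + intros x Hx. apply Hf, Hg, Hx.
    + intros x y Hx Hy L. destruct (Hg x Hx) as [Cx Ex], (Hg y Hy) as [Cy Ey].
      rewrite Ex, Ey in L. apply Hm; auto. eapply shift_mono_inv; eassumption.
  - intros b (Bb & Hlim) x. pose proof (shift_limpt C a b Hlim) as HCb.
    assert (Lba : b < a).
    { destruct Bb as (u & Cu & ->). specialize (Hb u Cu). pose proof (shift_le (C a) u). ord Hwo. }
    assert (Cb : forall x, C b x <-> C a x /\ x < b).
    { apply Hcoh. destruct HCb. split; auto. }
    assert (Hbel : forall u, u < b -> below (C b) u = below (C a) u).
    { intros u L. apply functional_extensionality. intro y. apply propositional_extensionality.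
      unfold below. rewrite Cb. split; [tauto|]. intros [? ?]. repeat split; auto. ord Hwo. }
    split.
    + intros (u & Cu & ->). apply Cb in Cu. destruct Cu as [Cu Lu]. rewrite Hbel; auto.
      split; [exists u; auto|]. pose proof (shift_le (C a) u). ord Hwo.
    + intros [(u & Cu & ->) L]. destruct (proj2 Hlim _ L) as (y & (v & Cv & ->) & L1 & L2).
      pose proof (shift_gt (C a) v u Cu (shift_mono_inv (C a) v u Cv Cu L1)).
      assert (Lu : u < b) by ord Hwo.
      exists u. rewrite Hbel; auto. split; auto. apply Cb. auto.
Qed.

Lemma shift_enum C a t h : enum lt (C a) t h ->
  enum lt (shift T C a) t (fun i => T (below (C a) (h i)) (h i)).
Proof.
  intros (HA & Hm & Hs). split; [|split].
  - intros i L. exists (h i). auto.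
  - intros i j Lij Lj. apply shift_mono; auto. apply HA. ord Hwo.
  - intros x (u & Cu & ->). destruct (Hs u Cu) as (i & L & <-). eauto.
Qed.

End Shift.

(** * Guessing *)

Lemma limit_succ t i : limit lt t -> i < t -> exists j, is_succ lt i j /\ j < t.
Proof.
  intros [_ Ht] Li. destruct (least lt Hwo (fun j => i < j)) as (j & Lij & Hj).
  - destruct (Ht i Li) as (j & L & _). eauto.
  - exists j. split; [split; auto|]. destruct (Ht i Li) as (k & L & Lk). specialize (Hj k L). ord Hwo.
Qed.

Lemma is_succ_unique i j k : is_succ lt i j -> is_succ lt i k -> j = k.
Proof. intros [? Hj] [? Hk]. apply (le_antisym lt Hwo); auto. Qed.

(** This inverts an injection witnessing lambda^t <= lambda: [Gam t x] is the function with number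
    [x]. *)
Lemma enum_pow : exists Gam : K -> K -> K -> K, forall t, t < lam -> forall g : K -> K,
  (forall i, i < t -> g i < lam) -> exists x, x < lam /\ forall i, i < t -> Gam t x i = g i.
Proof.
  apply (choice (fun t Gam => t < lam -> forall g : K -> K,
    (forall i, i < t -> g i < lam) -> exists x, x < lam /\ forall i, i < t -> Gam x i = g i)).
  intro t. destruct (classic (t < lam)) as [Lt|]; [|exists (fun _ i => i); tauto].
  destruct (small_pow t Lt) as [q Hq].
  destruct (choice (fun x (gam : K -> K) => forall g, proj1_sig (q g) = x ->
    forall i : seg lt t, gam (proj1_sig i) = proj1_sig (g i))) as [Gam HGam].
  - intro x. destruct (classic (exists g, proj1_sig (q g) = x)) as [[g Hg]|N].
    + destruct (choice (fun i v => forall L : i < t, v = proj1_sig (g (exist _ i L)))) as [gam Hgam].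
      { intro i. destruct (classic (i < t)) as [L|L]; [|exists i; tauto].
        exists (proj1_sig (g (exist _ i L))). intro L'. now rewrite (proof_irrelevance _ L L'). }
      exists gam. intros g' Hg'. rewrite <- Hg in Hg'. apply seg_eq, Hq in Hg'. subst g'.
      intros [i L]. apply Hgam.
    + exists (fun i => i). intros g Hg. exfalso. eauto.
  - exists Gam. intros _ g Hg.
    set (g' := fun i : seg lt t => exist (fun x => x < lam) (g (proj1_sig i)) (Hg _ (proj2_sig i))).
    exists (proj1_sig (q g')). split; [apply proj2_sig|].
    intros i L. exact (HGam _ g' eq_refl (exist _ i L)).
Qed.

(** By [small_fun] there are at most lambda^+ functions from [lambda * lambda] to [K]. Only
    arguments below lambda enter the code, so it determines [P] there alone. *)
Lemma enum_code : exists code : (K -> K -> K) -> K, forall P Q, code P = code Q ->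
  forall x i, x < lam -> i < lam -> P x i = Q x i.
Proof.
  destruct (small_fun _ (small_prod _ _ (small_seg lam) (small_seg lam))) as [f Hf].
  exists (fun P => f (fun p => P (proj1_sig (fst p)) (proj1_sig (snd p)))).
  intros P Q E x i Lx Li. apply Hf in E.
  exact (f_equal (fun F => F (exist _ x Lx, exist _ i Li)) E).
Qed.

Section Guess.
Context (C : K -> K -> Prop) (c : K -> K) (e : K -> K -> K) (Gam : K -> K -> K -> K)
  (code : (K -> K -> K) -> K)
  (Hc : forall t, t < lam -> limit lt t -> positive C t (fun b => c b = t))
  (He : forall b x, x < b -> e b x < lam)
  (Hinj : forall b x y, x < b -> y < b -> e b x = e b y -> x = y)
  (HGam : forall t, t < lam -> forall g : K -> K,
    (forall i, i < t -> g i < lam) -> exists x, x < lam /\ forall i, i < t -> Gam t x i = g i)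
  (Hcode : forall P Q, code P = code Q -> forall x i, x < lam -> i < lam -> P x i = Q x i).

(* [P x i] is the proposed position of the element with index [i + 1] inside [(h i, h j]]; the
   number [Gam t x i] tells how to find [P] from [h j] alone. *)
Definition good (t x : K) : Prop :=
  forall (A : K -> K -> Prop) (D : K -> Prop), (forall i, i < lam -> unbounded lt (A i)) -> club lt D ->
  exists a h, limit lt a /\ enum lt (C a) t h /\ (exists m, least_in (C a) m /\ c m = t) /\
    forall i j, is_succ lt i j -> j < t -> exists P, code P < h j /\
      e (h j) (code P) = Gam t x i /\ A i (P x i) /\ P x i <= h j /\
      exists d, D d /\ h i < d /\ d < P x i.

(* The counterexamples for all [x] are coded together, so a single guess refutes one of them. *)
Lemma good_ex t : t < lam -> limit lt t -> exists x, x < lam /\ good t x.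
Proof.
  intros Lt Ht. apply NNPP. intro N.
  assert (HAD : forall x, exists AD : (K -> K -> Prop) * (K -> Prop), x < lam ->
    (forall i, i < lam -> unbounded lt (fst AD i)) /\ club lt (snd AD) /\
    ~ exists a h, limit lt a /\ enum lt (C a) t h /\ (exists m, least_in (C a) m /\ c m = t) /\
    forall i j, is_succ lt i j -> j < t -> exists P, code P < h j /\
      e (h j) (code P) = Gam t x i /\ fst AD i (P x i) /\ P x i <= h j /\
      exists d, snd AD d /\ h i < d /\ d < P x i).
  { intro x. destruct (classic (x < lam)) as [Lx|];
      [|exists (fun _ _ => True, fun _ => True); tauto].
    apply NNPP. intro N'. apply N. exists x. split; auto. intros A D HA HD.
    apply NNPP. intro N''. apply N'. exists (A, D). auto. }
  apply choice in HAD. destruct HAD as [AD HAD].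
  (* [p b] serves all counterexamples at once: for every [x] and [i] it passes a point of the club
     beyond [b] and then picks an element of the [i]-th set. *)
  assert (Hp : forall b, exists p : K -> K -> K, forall x i, x < lam -> i < lam ->
    fst (AD x) i (p x i) /\ exists d, snd (AD x) d /\ b < d /\ d < p x i).
  { intro b. destruct (choice (fun (q : K * K) y => fst q < lam -> snd q < lam ->
      fst (AD (fst q)) (snd q) y /\ exists d, snd (AD (fst q)) d /\ b < d /\ d < y)) as [p Hp].
    - intros [x i]. simpl. destruct (classic (x < lam /\ i < lam)) as [[Lx Li]|]; [|exists x; tauto].
      destruct (HAD x Lx) as (HA & [HD _] & _). destruct (HD b) as (d & Dd & Ld).
      destruct (HA i Li d) as (y & Ay & Ly). exists y. eauto.
    - exists (fun x i => p (x, i)). intros x i Lx Li. exact (Hp (x, i) Lx Li). }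
  apply choice in Hp. destruct Hp as [p Hp].
  (* On closure points, the code and the values of [p (h i)] lie below the next element [h j]. The
     [nat] index merely presents a single function as a small family. *)
  destruct (Hc t Lt Ht (fun b => (forall d, d < b -> forall q : seg lt lam * seg lt lam,
      p d (proj1_sig (fst q)) (proj1_sig (snd q)) < b) /\
    (forall d, d < b -> forall q : nat, code (p d) < b))) as (a & Ha & Hotp & Hsub & Hm).
  { apply inter2_club.
    - apply (closure_club _ (fun q d => p d (proj1_sig (fst q)) (proj1_sig (snd q)))).
      apply small_prod; apply small_seg.
    - apply (closure_club _ (fun q d => code (p d)) nat_seg_lam). }
  apply (otp_eq_enum lt Hwo) in Hotp. destruct Hotp as [h Hh].
  assert (Hstep : forall i j, is_succ lt i j -> j < t -> code (p (h i)) < h j /\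
    forall x, x < lam -> p (h i) x i < h j).
  { intros i j [Lij _] Lj. destruct Hh as (HA & Hmono & _).
    destruct (Hsub _ (HA j Lj)) as [H1 H2]. specialize (Hmono i j Lij Lj). split.
    - apply (H2 (h i) Hmono 0).
    - intros x Lx. assert (Li : i < lam) by ord Hwo.
      exact (H1 (h i) Hmono (exist _ x Lx, exist _ i Li)). }
  (* [g i] is the name, at [h j], of the code of [p (h i)]; the number [x] of [g] then defeats its
     own counterexample. *)
  destruct (choice (fun i v => forall j, is_succ lt i j -> v = e (h j) (code (p (h i))))) as [g Hg].
  { intro i. destruct (classic (exists j, is_succ lt i j)) as [[j Hj]|N'].
    - exists (e (h j) (code (p (h i)))). intros k Hk. now rewrite (is_succ_unique i j k).
    - exists i. intros j Hj. exfalso. eauto. }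
  destruct (HGam t Lt g) as (x & Lx & Hx).
  { intros i Li. destruct (limit_succ t i Ht Li) as (j & Hj & Lj). rewrite (Hg i j Hj).
    apply He. now apply Hstep. }
  destruct (HAD x Lx) as (_ & _ & Nx). apply Nx. exists a, h. split; [|split; [|split]]; auto.
  intros i j Hj Lj. destruct (Hstep i j Hj Lj) as [H1 H2].
  assert (Li : i < t) by (destruct Hj; ord Hwo). assert (Li' : i < lam) by ord Hwo.
  exists (p (h i)). destruct (Hp (h i) x i Lx Li') as [H3 H4].
  split; [|split; [|split; [|split]]]; auto.
  - rewrite (Hx i Li). now rewrite (Hg i j Hj).
  - left. auto.
Qed.

(* [b < y <= u] makes [move] admissible for [shift]; [P] is not determined by [code P], but its
   relevant value is. *)
Definition step (w : K -> K) (S : K -> Prop) (u y : K) : Prop :=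
  exists m b i P, least_in S m /\ last_in S b /\ elem_at lt S i b /\ code P < u /\
    e u (code P) = Gam (c m) (w (c m)) i /\ y = P (w (c m)) i /\ b < y /\ y <= u.

Definition move (w : K -> K) (S : K -> Prop) (u : K) : K :=
  match excluded_middle_informative (exists y, step w S u y) with
  | left H => proj1_sig (constructive_indefinite_description _ H)
  | right _ => u
  end.

Lemma move_spec w S u :
  step w S u (move w S u) \/ move w S u = u /\ ~ exists y, step w S u y.
Proof.
  unfold move. destruct (excluded_middle_informative _); auto. left. apply proj2_sig.
Qed.

Lemma move_no_last w S u : no_last S -> move w S u = u.
Proof.
  intro H. destruct (move_spec w S u) as [(m & b & i & P & _ & [Sb Hb] & _)|[? _]]; auto.
  destruct (H b Sb) as (y & Sy & L). specialize (Hb y Sy). ord Hwo.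
Qed.

Lemma last_in_unique S b b' : last_in S b -> last_in S b' -> b = b'.
Proof. intros [? H] [? H']. apply (le_antisym lt Hwo); auto. Qed.

Lemma least_in_unique S b b' : least_in S b -> least_in S b' -> b = b'.
Proof. intros [? H] [? H']. apply (le_antisym lt Hwo); auto. Qed.

Lemma move_last w S u b : last_in S b -> b < u -> b < move w S u /\ move w S u <= u.
Proof.
  intros Hb L. destruct (move_spec w S u) as [(m & b' & i & P & _ & Hb' & _ & _ & _ & _ & H)|[-> _]].
  - now rewrite (last_in_unique S b b').
  - split; auto. apply le_refl.
Qed.

(** Any two proposals have the same name, hence the same code by injectivity of [e u], hence the
    same value; so the choice made in [move] is immaterial. *)
Lemma move_eq w S u m b i P : least_in S m -> last_in S b -> elem_at lt S i b ->
  w (c m) < lam -> i < lam -> code P < u -> e u (code P) = Gam (c m) (w (c m)) i ->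
  b < P (w (c m)) i -> P (w (c m)) i <= u -> move w S u = P (w (c m)) i.
Proof.
  intros Hm Hb Hi Lw Li LP EP L1 L2. destruct (move_spec w S u) as [H|[_ N]].
  - destruct H as (m' & b' & i' & P' & Hm' & Hb' & Hi' & LP' & EP' & -> & _).
    rewrite <- (least_in_unique S m m') in * by auto.
    rewrite <- (last_in_unique S b b') in * by auto.
    rewrite <- (elem_at_unique lt Hwo S i i' b) in * by auto.
    apply Hcode; auto. apply (Hinj u); auto. congruence.
  - exfalso. apply N. exists (P (w (c m)) i), m, b, i, P. repeat split; auto; apply Hm || apply Hb || apply Hi.
Qed.

Lemma move_guess : is_square lt lam C -> clubsuit_square lt lam.
Proof.
  intro HC.
  (* [w t] is a good number for [t]; [move w] recovers [t] as the colour of the least element of the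
     club. *)
  destruct (choice (fun t x => t < lam -> limit lt t -> x < lam /\ good t x)) as [w Hw].
  { intro t. destruct (classic (t < lam /\ limit lt t)) as [[Lt Ht]|]; [|exists t; tauto].
    destruct (good_ex t Lt Ht) as [x Hx]. exists x. auto. }
  exists (shift (move w) C).
  split; [apply shift_square; auto using move_no_last, move_last|].
  intros A HA t Lt Ht D HD. destruct (Hw t Lt Ht) as [Lw Hgood].
  destruct (Hgood A D HA HD) as (a & h & Ha & Hh & (m & Hm & Hcm) & Hstep).
  pose proof (shift_enum (move w) (move_no_last w) (move_last w) C a t h Hh) as Hsh.
  exists a. split; auto. split; [apply (otp_eq_enum lt Hwo); eauto|].
  intros i Li. destruct (limit_succ t i Ht Li) as (j & Hj & Lj).
  destruct (Hstep i j Hj Lj) as (P & LP & EP & HP & LPj & d & Dd & Lid & LdP).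
  exists j. do 2 eexists. split; [exact Hj|].
  split; [exact (enum_elem_at lt Hwo _ _ _ i Hsh Li)|].
  split; [exact (enum_elem_at lt Hwo _ _ _ j Hsh Lj)|]. cbv beta.
  destruct Hh as (HhA & Hmono & Hsur). destruct Hj as [Lij Hj].
  pose proof (Hmono i j Lij Lj) as Lhij.
  (* [C a] below [h j] has least element [m] of colour [t] and last element [h i] of index [i], so
     [move_eq] applies. *)
  assert (Hmv : move w (below (C a) (h j)) (h j) = P (w t) i).
  { rewrite <- Hcm in *. apply (move_eq w _ _ m (h i)); auto.
    - split; [split; [apply Hm|]|].
      + destruct Hm as [_ Hm]. specialize (Hm _ (HhA i Li)). ord Hwo.
      + intros x [Cx _]. now apply Hm.
    - split; [split; auto|]. intros x [Cx Lx]. destruct (Hsur x Cx) as (k & Lk & <-).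
      destruct (classic (k <= i)) as [[L| ->]|L].
      + left. auto.
      + apply le_refl.
      + exfalso. apply (not_le lt Hwo) in L. specialize (Hj k L).
        destruct Hj as [L'| ->]; [specialize (Hmono j k L' Lk)|]; ord Hwo.
    - apply (enum_elem_at lt Hwo (below (C a) (h j)) j h); auto. split; [|split].
      + intros k Lk. split; auto. apply HhA. ord Hwo.
      + intros k l Lkl Ll. apply Hmono; auto. ord Hwo.
      + intros x [Cx Lx]. destruct (Hsur x Cx) as (k & Lk & <-). exists k. split; auto.
        apply (mono_inj lt Hwo h (c m)); auto.
    - ord Hwo.
    - ord Hwo. }
  rewrite Hmv. split; auto. exists d. split; auto. split; auto.
  (* The element of index [i] may have moved too, but only downwards, so [d] above [h i] still
     exceeds it. *)
  pose proof (shift_le (move w) (move_no_last w) (move_last w) (C a) (h i)). ord Hwo.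
Qed.

End Guess.
End Cardinals.

Theorem theorem3p3 (K : Type) (lt : K -> K -> Prop) (lam : K)
  (Hwo : strict_well_order lt)
  (* K has order type lambda^+, where lambda = lam *)
  (HK_seg : forall x : K, card_le (seg lt x) (seg lt lam))
  (HK_big : ~ card_le K (seg lt lam))
  (* lambda is a successor cardinal: lambda = |mu|^+ with mu infinite *)
  (Hsucc : exists mu, lt mu lam /\ card_le nat (seg lt mu) /\
            ~ card_le (seg lt lam) (seg lt mu) /\
            (forall x, lt x lam -> card_le (seg lt x) (seg lt mu)))
  (* lambda^{<lambda} < lambda^lambda *)
  (Hlt : card_lt { m : { m : K | lt m lam } & seg lt (proj1_sig m) -> seg lt lam }
                 (seg lt lam -> seg lt lam))
  (* lambda^lambda = lambda^+ *)
  (Heq : card_eq (seg lt lam -> seg lt lam) K)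
  (* square_lambda holds *)
  (Hsq : exists C : K -> K -> Prop, is_square lt lam C) :
  clubsuit_square lt lam.
Proof.
  destruct Hsq as [C0 HC0].
  destruct (square_guesses lt lam Hwo HK_seg HK_big Hsucc Hlt Heq C0 HC0) as (C & HC & Hg).
  destruct (colouring lt lam Hwo HK_seg HK_big Hsucc Hlt Heq C Hg) as [c Hc].
  destruct (seg_inj lt lam HK_seg) as (e & He & Hinj).
  destruct (enum_pow lt lam Hwo HK_seg Hsucc Hlt Heq) as [Gam HGam].
  destruct (enum_code lt lam Hwo HK_seg Hsucc Hlt Heq) as [code Hcode].
  eapply move_guess; eassumption.
Qed.
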